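(* For every infinite Tychonoff space $X$, the free locally convex space $L(X)$ does not have the Josefson--Nissenzweig property (JNP).
   Context: All locally convex spaces (lcs) are over the field $\mathbb{F}$ of real or complex numbers, Hausdorff and infinite-dimensional. $E'$ is the topological dual of $E$. A barrel in an lcs $E$ is a closed absorbent absolutely convex subset. A set $B\subseteq E$ is barrel-bounded if for every barrel $U\subseteq E$ there is $n\in\mathbb{N}$ with $B\subseteq nU$. The topology $\beta^*(E',E)$ on $E'$ is the locally convex topology of uniform convergence on barrel-bounded subsets of $E$: a neighborhood base at zero is given by the polars $B^\circ=\{\chi\in E': |\chi(x)|\le 1 \text{ for all } x\in B\}$ of barrel-bounded sets $B\subseteq E$. $E'_{w^*}$ is $E'$ with the weak$^*$ topology $\sigma(E',E)$ and $E'_{\beta^*}$ is $E'$ with $\beta^*(E',E)$. The space $E$ has the Josefson--Nissenzweig property (JNP) if the identity map $E'_{w^*}\to E'_{\beta^*}$ is not sequentially continuous; equivalently, there is a sequence in $E'$ converging to $0$ in $\sigma(E',E)$ but not in $\beta^*(E',E)$. The free locally convex space $L(X)$ on a Tychonoff space $X$ is a pair consisting of a locally convex space $L(X)$ and a continuous map $i:X\to L(X)$ such that for every continuous map $f$ from $X$ to a locally convex space $E$ there is a unique continuous linear operator $\bar f:L(X)\to E$ with $f=\bar f\circ i$. It always exists and is essentially unique; $i$ is a topological embedding and $i(X)$ is a Hamel basis of $L(X)$. *)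

(* Defs.v *)
From HB Require Import structures.
From mathcomp Require Import all_boot all_order all_algebra.
From mathcomp Require Import complex.
From mathcomp Require Import all_classical all_reals all_analysis.

Set Implicit Arguments.
Unset Strict Implicit.
Unset Printing Implicit Defensive.

Import Order.TTheory GRing.Theory Num.Theory.
Import numFieldNormedType.Exports.

Local Open Scope classical_set_scope.
Local Open Scope ring_scope.

Inductive real_or_complex (R : realType) : numFieldType -> Prop :=
| scalars_real : real_or_complex R R
| scalars_complex : real_or_complex R R[i].

(* [uniform_separatorP] recovers the usual separation of points from closed
   sets by continuous real-valued functions. *)
Definition tychonoff_space (X : topologicalType) : Prop :=
  hausdorff_space X /\ completely_regular_space X.

Section lcs.
Context {K : numFieldType}.

(* A locally convex space is a Hausdorff [tvsType K] (local convexity is part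
   of [tvsType]).  A [tvsType] also carries a uniformity inducing its topology;
   nothing below depends on which one. *)
Implicit Types E L : tvsType K.

(* The order of [K] only compares [a] and [b] when [b - a] is real, so [0 < r]
   makes [r] a positive real also when [K] is the field of complex numbers. *)
Definition absorbent E (U : set E) : Prop :=
  forall x : E, exists2 r : K, 0 < r &
    forall a : K, r <= `|a| -> (( *:%R a) @` U) x.

Definition absolutely_convex E (U : set E) : Prop :=
  forall (x y : E) (a b : K), U x -> U y -> `|a| + `|b| <= 1 ->
    U (a *: x + b *: y).

Definition barrel E (U : set E) : Prop :=
  [/\ closed U, absorbent U & absolutely_convex U].

Definition barrel_bounded E (B : set E) : Prop :=
  forall U : set E, barrel U -> exists n : nat, B `<=` ( *:%R n%:R) @` U.

Definition dual E : set (E -> K^o) := [set f | linear f /\ continuous f].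

(* The two topologies on the dual: the subtype topologies induced by pointwise
   convergence on [E] and by uniform convergence on barrel-bounded sets.  Over
   the real and complex numbers barrel-bounded sets are stable under scaling
   and finite unions, so their polars form a base at 0 of the second one. *)
Definition dual_weak_star E : topologicalType :=
  set_type (@dual E : set {ptws E -> K^o}).

Definition dual_beta_star E : topologicalType :=
  set_type (@dual E : set {family @barrel_bounded E, E -> K^o}).

Definition sequentially_continuous (S T : topologicalType) (f : S -> T) : Prop :=
  forall (u : nat -> S) (x : S), u @ \oo --> x -> (f \o u) @ \oo --> f x.

Definition JNP E : Prop :=
  ~ sequentially_continuous (fun chi : dual_weak_star E =>
                               (chi : dual_beta_star E)).

(* [E] ranges over all Hausdorff locally convex spaces, finite-dimensional ones
   included. *)
Definition free_lcs (X : topologicalType) L (i : X -> L) : Prop :=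
  [/\ hausdorff_space L, continuous i &
      forall E, hausdorff_space E -> forall f : X -> E, continuous f ->
        exists! g : L -> E, [/\ linear g, continuous g & f = g \o i]].

End lcs.

(* Main.v *)
Require Import Defs.
From HB Require Import structures.
From mathcomp Require Import all_boot all_order all_algebra.
From mathcomp Require Import complex.
From mathcomp Require Import all_classical all_reals all_analysis.

(* Barrel-bounded subsets of L(X) are bounded in a finite-dimensional subspace,
   so weak* convergent sequences converge uniformly on them.  Indeed, if the
   supports of the elements of B meet infinitely many points, choose infinitely
   many such points x_n with pairwise disjoint neighbourhoods V_n, elements b_n
   of B, and functionals phi_n "supported in V_n" with |phi_n(b_n)| > n.  Since
   the V_n are disjoint and L(X) is spanned by X, the phi_n are pointwise
   bounded, so their polar is a barrel, and no multiple of it contains B. *)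

Set Implicit Arguments.
Unset Strict Implicit.
Unset Printing Implicit Defensive.

Import Order.TTheory GRing.Theory Num.Theory.
Import numFieldNormedType.Exports.

Local Open Scope classical_set_scope.
Local Open Scope ring_scope.

(* The type mentions the closure proof so that the instances below, which need
   it, can be inferred. *)
Definition subspace_tvs (K : numFieldType) (L : tvsType K) (P : {pred L})
  of submod_closed P : Type := {x | x \in P}.

(** * Linear subspaces as locally convex spaces *)

Section subspace_tvs.
Context (K : numFieldType) (L : tvsType K) (P : {pred L}) (Pc : submod_closed P).

Local Notation M := (subspace_tvs Pc).
HB.instance Definition _ := GRing.isSubmodClosed.Build K L P Pc.
HB.instance Definition _ := SubChoice.copy M {x | x \in P}.
HB.instance Definition _ := [SubChoice_isSubLmodule of M by <:].
HB.instance Definition _ := Uniform.copy M (initial_topology (val : M -> L)).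

Lemma subspace_val_continuous : continuous (val : M -> L).
Proof. exact: initial_continuous. Qed.

Lemma subspace_continuous (T : topologicalType) (f : T -> M) :
  continuous (val \o f : T -> L) -> continuous f.
Proof. exact: continuous_comp_initial. Qed.

Lemma subspace_hausdorff : hausdorff_space L -> hausdorff_space M.
Proof.
move=> hL p q pq; apply: val_inj; apply: hL => A B.
by move=> /subspace_val_continuous Ap /subspace_val_continuous Bq;
   have [z []] := pq _ _ Ap Bq; exists (val z).
Qed.

Let subspace_add_continuous : continuous (fun x : M * M => x.1 + x.2).
Proof.
apply: subspace_continuous => z.
rewrite (_ : val \o _ = fun x : M * M => (val x.1 : L) + val x.2) //.
apply: (@continuous2_cvg _ L L L _ _ (fun x : M * M => val x.1) (val \o snd)
  +%R (val z.1) (val z.2)).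
- exact: (@add_continuous L (val z.1, val z.2)).
- by apply: continuous_comp; [exact: cvg_fst|exact: subspace_val_continuous].
- by apply: continuous_comp; [exact: cvg_snd|exact: subspace_val_continuous].
Qed.

Let subspace_scale_continuous : continuous (fun z : K^o * M => z.1 *: z.2).
Proof.
apply: subspace_continuous => z.
rewrite (_ : val \o _ = fun x : K^o * M => x.1 *: (val x.2 : L)) //.
apply: (@continuous2_cvg _ K^o L L _ _ (fst : K^o * M -> K^o) (val \o snd)
  *:%R z.1 (val z.2)).
- exact: (@scale_continuous K L (z.1, val z.2)).
- exact: cvg_fst.
- by apply: continuous_comp; [exact: cvg_snd|exact: subspace_val_continuous].
Qed.

(** Preimages under the linear map [val] of the convex basic open sets of [L] are convex and form a
    base of the induced topology. *)
Let subspace_locally_convex :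
  exists2 B : set_system M, (forall b, b \in B -> convex_set b) & basis B.
Proof.
have [B Bconvex [Bopen Bbasis]] := @locally_convex K L.
exists [set (val : M -> L) @^-1` b | b in B].
  move=> _ /[!inE] -[b Bb <-] x y l /[!inE]/= bx byy.
  have /Bconvex : b \in B by rewrite inE.
  move=> /(_ (val x) (val y) l); rewrite !inE => /(_ bx byy).
  by [].
split=> [_ [b Bb <-]|x A].
  by exists b => //; exact: Bopen.
move=> [_ [[U oU <-] Ux] UA].
have [|b [Bb bx] bU] := Bbasis (val x) U; first exact: open_nbhs_nbhs.
exists (val @^-1` b); first by split => //; exists b.
by move=> y /bU /UA.
Qed.

HB.instance Definition _ :=
  PreTopologicalNmodule_isTopologicalNmodule.Build M subspace_add_continuous.
HB.instance Definition _ :=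
  TopologicalNmodule_isTopologicalLmodule.Build K M subspace_scale_continuous.
HB.instance Definition _ := Uniform_isTvs.Build K M subspace_locally_convex.

End subspace_tvs.

(* Factor i through P: by uniqueness, the extension L -> P of i followed by the
   inclusion P -> L is the identity. *)
Lemma free_lcs_span (K : numFieldType) (X : topologicalType) (L : tvsType K)
    (i : X -> L) (P : {pred L}) :
  free_lcs i -> submod_closed P -> (forall x, i x \in P) -> forall v, v \in P.
Proof.
move=> [hL ic univ] Pc iP v.
pose i' x : subspace_tvs Pc := exist _ (i x) (iP x).
have i'c : continuous i' by apply: subspace_continuous.
have [g [[gl gc gi] _]] := univ (subspace_tvs Pc) (subspace_hausdorff hL) _ i'c.
have [h [_ uh]] := univ _ hL _ ic.
have hid : h = id.
  by apply: uh; split=> // x; exact: cvg_id.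
have : h = val \o g.
  apply: uh; split.
  - by move=> a x y /=; rewrite gl.
  - by move=> x; apply: continuous_comp; [exact: gc|exact: subspace_val_continuous].
  - by apply/funext => x; rewrite /= -[g (i x)]/((g \o i) x) -gi.
by rewrite hid => /(congr1 (@^~ v)) /= ->; exact: valP.
Qed.

(** * Real and complex scalars *)

Lemma real_or_complex_archi (R : realType) (K : numFieldType) (x : K) :
  real_or_complex R K -> exists n : nat, `|x| <= n%:R.
Proof.
move=> HK; case: K / HK x => x.
  by exists (Num.bound `|x|); rewrite ltW// archi_boundP.
exists (Num.bound (Num.sqrt (complex.Re x ^+ 2 + complex.Im x ^+ 2))).
rewrite normc_def -[_%:R](rmorph_nat (real_complex R)) lecR ltW//.
by apply: archi_boundP; rewrite sqrtr_ge0.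
Qed.

(** Composition with [j] turns real bump functions into scalar-valued ones. *)
Lemma real_or_complex_embedding (R : realType) (K : numFieldType) :
  real_or_complex R K ->
  exists j : R -> K^o, [/\ continuous j, j 0 = 0 & j 1 = 1].
Proof.
case=> [|]; first by exists id; split=> // x; exact: cvg_id.
exists (real_complex R); split=> // x; apply/cvgrPdist_lt => e e0.
(* A positive element of [R[i]] is real, so the estimate reduces to one in [R]. *)
have eE : e = (complex.Re e)%:C%C by rewrite complex.RRe_real// gtr0_real.
have Re0 : 0 < complex.Re e by move: e0; rewrite eE ltcR.
near=> y; rewrite -rmorphB/= normc_def/= expr0n/= addr0 sqrtr_sqr eE ltcR.
by near: y; apply: (@cvgr_dist_lt _ R _ (nbhs x) _ id x) => //; exact: cvg_id.
Unshelve. all: by end_near. Qed.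

(** * Disjoint open sets in Tychonoff spaces *)

Section disjoint_opens.
Context (R : realType) (X : topologicalType) (HX : tychonoff_space X).

Lemma tychonoff_closed_finite (S : set X) : finite_set S -> closed S.
Proof.
by move: S; apply/accessible_finite_set_closed/hausdorff_accessible/HX.1.
Qed.

Lemma tychonoff_bump (U : set X) (x : X) : open U -> U x ->
  exists f : X -> R, [/\ continuous f, f x = 1 & forall y, ~ U y -> f y = 0].
Proof.
move=> oU Ux.
have : uniform_separator [set x] (~` U).
  by apply: HX.2; [rewrite closedC|apply].
move=> /(@uniform_separatorP _ R)[f [cf _ fx fU]].
exists (fun y => 1 - f y); split.
- by move=> y; apply: cvgB; [exact: cvg_cst|exact: cf].
- by rewrite (fx (f x)) ?subr0//; exists x.
- by move=> y nUy; rewrite (fU (f y)) ?subrr//; exists y.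
Qed.

(** Two points a, b of A in O are separated by f with f a = 1 and f b = 0. Either infinitely many
    points of A in O have f < 1/2, and a is split off by f > 1/2, or almost all have f >= 1/2, and b
    is split off. *)
Lemma infinite_split (A O : set X) : open O -> infinite_set (A `&` O) ->
  exists x V O', [/\ [/\ A x, open V, V x & V `<=` O],
    open O', O' `<=` O, V `&` O' = set0 & infinite_set (A `&` O')].
Proof.
move=> oO AOinf.
have [a [Aa Oa]] := infinite_setN0 AOinf.
have [b [[Ab Ob] nab]] : (A `&` O) `\` [set a] !=set0.
  by apply: infinite_setN0; apply: infinite_setD.
have [f [cf fa fb]] : exists f : X -> R, [/\ continuous f, f a = 1 & f b = 0].
  have ob : open (~` [set b]) by rewrite openC; exact: tychonoff_closed_finite.
  have [|f [cf fa fb]] := tychonoff_bump (x := a) ob.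
    by move=> /= ab; apply: nab.
  by exists f; split=> //; apply: fb => /=; apply.
have olt c : open (O `&` [set y | f y < c]).
  apply: openI => //; suff : open (f @^-1` [set z | z < c]) by [].
  by apply: open_comp => [y _|]; [exact: cf|exact: open_lt].
have ogt c : open (O `&` [set y | c < f y]).
  apply: openI => //; suff : open (f @^-1` [set z | c < z]) by [].
  by apply: open_comp => [y _|]; [exact: cf|exact: open_gt].
have [fin|inf] := pselect (finite_set (A `&` (O `&` [set y | f y < 2^-1]))).
(* The threshold 1/3 < 1/2 puts the points with f >= 1/2 into the open set f > 1/3. *)
- exists b, (O `&` [set y | f y < 3^-1]), (O `&` [set y | 3^-1 < f y]).
  split=> //; first by split=> //; split=> //=; rewrite fb invr_gt0.
  + by rewrite -subset0 => y [[_ /= +] [_ /= yn]]; rewrite ltNge ltW.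
  + move=> fin'; apply: AOinf.
    apply: (@sub_finite_set _ _ ((A `&` (O `&` [set y | f y < 2^-1]))
        `|` (A `&` (O `&` [set y | 3^-1 < f y])))); last by rewrite finite_setU.
    move=> y [Ay Oy].
    have [|h] := ltP (f y) 2^-1; [by left|right; split=> //; split=> //=].
    by apply: lt_le_trans h; rewrite ltf_pV2 ?posrE// ltr_nat.
- exists a, (O `&` [set y | 2^-1 < f y]), (O `&` [set y | f y < 2^-1]).
  split=> //; first by split=> //; split=> //=; rewrite fa invf_lt1// ltr1n.
  by rewrite -subset0 => y [[_ /= +] [_ /= yn]]; rewrite ltNge ltW.
Qed.

Lemma infinite_disjoint_opens (A : set X) : infinite_set A ->
  exists (x : nat -> X) (V : nat -> set X),
    (forall n, [/\ A (x n), open (V n) & V n (x n)]) /\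
    (forall m n y, V m y -> V n y -> m = n).
Proof.
move=> Ainf.
(* State of the recursion: an open set still containing infinitely many points of A. *)
pose T := {O : set X | open O /\ infinite_set (A `&` O)}.
have step (O : T) : exists p : X * set X * T,
    [/\ A p.1.1, open p.1.2, p.1.2 p.1.1, p.1.2 `<=` sval O
      & sval p.2 `<=` sval O /\ p.1.2 `&` sval p.2 = set0].
  case: O => O [oO iO] /=.
  have [x [V [W [[Ax oV Vx VO] oW WO VW iW]]]] := infinite_split oO iO.
  by exists (x, V, exist _ W (conj oW iW)); split.
have [F FP] := choice step.
have T0 : open [set: X] /\ infinite_set (A `&` setT).
  by split; [exact: openT|rewrite setIT].
pose O n := iter n (fun t => (F t).2) (exist _ setT T0 : T).
have Ole m n : (m <= n)%N -> sval (O n) `<=` sval (O m).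
  move=> /subnK <-; elim: (n - m)%N => // k IH.
  by have [_ _ _ _ [h _]] := FP (O (k + m)%N); exact: subset_trans h IH.
pose V n := (F (O n)).1.2.
(* For m < n, V n lies in O n, hence in O (m+1), which misses V m. *)
have Vdisj m n y : (m < n)%N -> V m y -> ~ V n y.
  move=> mn Vm Vn; have [_ _ _ _ [_ h]] := FP (O m).
  have [_ _ _ VO _] := FP (O n).
  suff : (V m `&` sval (O m.+1)) y by rewrite h.
  by split=> //; apply: (Ole _ _ mn); exact: VO.
exists (fun n => (F (O n)).1.1), V; split=> [n|m n y Vm Vn].
  by have [] := FP (O n).
by have [/Vdisj h|/Vdisj h|//] := ltngtP m n; [have := h _ Vm Vn|have := h _ Vn Vm].
Qed.

End disjoint_opens.

(** * Functionals and barrels *)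

Lemma dual_linear (K : numFieldType) (L : tvsType K) (f : L -> K^o) :
  dual f -> exists g : {linear L -> K^o}, f = g.
Proof.
move=> [fl _].
pose g : {linear L -> K^o} := HB.pack f (GRing.isLinear.Build K L K^o *:%R f fl).
by exists g.
Qed.

Section barrels.
Context (K : numFieldType) (L : tvsType K).

Lemma closed_norm_le (r : K) : 0 <= r -> closed [set a : K^o | `|a| <= r].
Proof.
move=> r0 x clx; rewrite /= real_leNgt ?ger0_real//; apply/negP => rx.
(* The ball of this radius around x would miss the set. *)
have e0 : 0 < `|x| - r by rewrite subr_gt0.
have [y [/= yr]] := clx _ (nbhsx_ballx x _ e0).
rewrite -ball_normE /= ltrBrDr => xy.
have := ler_normD (x - y) y; rewrite subrK => /le_lt_trans/(_ (le_lt_trans (lerD (lexx _) yr) xy)).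
by rewrite ltxx.
Qed.

(** Pointwise boundedness is what makes the polar absorbent: a bound r at v puts v in a times the
    polar once |a| >= r. *)
Lemma polar_barrel (I : Type) (phi : I -> L -> K^o) :
  (forall n, dual (phi n)) ->
  (forall v, exists2 r : K, 0 < r & forall n, `|phi n v| <= r) ->
  barrel [set v | forall n, `|phi n v| <= 1].
Proof.
move=> dphi bphi; split.
- rewrite (_ : [set _ | _] = \bigcap_n (phi n @^-1` [set a | `|a| <= 1])); last first.
    by apply/seteqP; split=> v /= h n; [move=> _|]; exact: h.
  apply: closed_bigI => n _; apply: (closed_comp _ (closed_norm_le ler01)).
  by move=> v _; exact: (dphi n).2.
- move=> v; have [r r0 rv] := bphi v; exists r => // a ra.
  have a0 : 0 < `|a| := lt_le_trans r0 ra.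
  have an0 : a != 0 by rewrite -normr_gt0.
  exists (a^-1 *: v); last by rewrite /= scalerA divff// scale1r.
  move=> n /=; have [f fE] := dual_linear (dphi n).
  rewrite fE linearZ -fE normrZ normfV mulrC ler_pdivrMr// mul1r.
  exact: le_trans (rv n) ra.
- move=> x y a b Ux Uy ab n.
  have [f fE] := dual_linear (dphi n).
  rewrite fE linearD !linearZ -fE; apply: le_trans (ler_normD _ _) _.
  by apply: le_trans ab; rewrite !normrZ lerD// ler_piMr.
Qed.

(** A uniform boundedness principle: the polar of the family is a barrel, so some multiple of it
    contains B. *)
Lemma barrel_bounded_functionals (I : Type) (phi : I -> L -> K^o) (B : set L) :
  (forall n, dual (phi n)) ->
  (forall v, exists2 r : K, 0 < r & forall n, `|phi n v| <= r) ->
  barrel_bounded B ->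
  exists m : nat, forall n v, B v -> `|phi n v| <= m%:R.
Proof.
move=> dphi bphi /(_ _ (polar_barrel dphi bphi))[m Bm]; exists m => n v /Bm[u Uu <-].
have [f fE] := dual_linear (dphi n).
by rewrite fE linearZ -fE normrZ normr_nat ler_piMr.
Qed.

End barrels.

(** * Supports and barrel-bounded sets in the free space *)

Section free_lcs_theory.
Context (R : realType) (K : numFieldType) (HK : real_or_complex R K).
Context (X : topologicalType) (HX : tychonoff_space X).
Context (L : tvsType K) (i : X -> L) (HL : free_lcs i).

Lemma free_lcs_bump (U : set X) (x : X) : open U -> U x ->
  exists g : L -> K^o, [/\ dual g, g (i x) = 1 & forall y, ~ U y -> g (i y) = 0].
Proof.
move=> oU Ux; have [f [cf fx fU]] := tychonoff_bump R HX oU Ux.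
have [j [cj j0 j1]] := real_or_complex_embedding HK.
have [_ _ univ] := HL.
have cjf : continuous (j \o f).
  by move=> y; apply: continuous_comp; [exact: cf|exact: cj].
have [g [[gl gc gi] _]] := univ K^o (@norm_hausdorff K K^o) _ cjf.
have giE y : g (i y) = j (f y) by rewrite -[RHS]/((j \o f) y) gi.
exists g; split; first by split.
  by rewrite giE fx.
by move=> y /fU fy; rewrite giE fy.
Qed.

(* The support of v as a functional on the continuous functions on X; the
   functional g stands for the function g \o i. *)
Definition in_support (v : L) (x : X) :=
  forall U, open U -> U x -> exists g : L -> K^o,
    [/\ dual g, g v != 0 & forall y, ~ U y -> g (i y) = 0].

Let spanned (s : seq X) (v : L) :=
  exists c : X -> K, v = \sum_(x <- s) c x *: i x.

Let spannedW (s t : seq X) v : uniq s -> uniq t -> {subset s <= t} ->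
  spanned s v -> spanned t v.
Proof.
move=> us ut st [c ->]; exists (fun x => if x \in s then c x else 0).
rewrite [RHS](eq_bigr (fun x => if x \in s then c x *: i x else 0)); last first.
  by move=> x _ /=; case: ifP => // _; rewrite scale0r.
rewrite -big_mkcond -big_filter; apply: perm_big; apply: uniq_perm => //.
  exact: filter_uniq.
by move=> x; rewrite mem_filter andb_idr//; exact: st.
Qed.

(** The combinations of points of X form a subspace containing the image of [i], hence everything;
    terms with zero coefficient are then dropped. *)
Lemma free_lcs_decomp (v : L) : exists (s : seq X) (c : X -> K),
  [/\ uniq s, v = \sum_(x <- s) c x *: i x & forall x, x \in s -> c x != 0].
Proof.
pose P : {pred L} := [pred v | `[< exists s, uniq s /\ spanned s v >]].
have : v \in P.
  apply: (free_lcs_span HL) => [|x]; last first.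
    apply/asboolP; exists [:: x]; split=> //.
    by exists (fun=> 1); rewrite big_seq1 scale1r.
  split.
    by apply/asboolP; exists [::]; split=> //; exists (fun=> 0); rewrite big_nil.
  move=> a u w /asboolP[s [us su]] /asboolP[t [ut tw]].
  apply/asboolP; exists (undup (s ++ t)); split; first exact: undup_uniq.
  have [|c uE] := @spannedW s (undup (s ++ t)) u us (undup_uniq _) _ su.
    by move=> x xs; rewrite mem_undup mem_cat xs.
  have [|d wE] := @spannedW t (undup (s ++ t)) w ut (undup_uniq _) _ tw.
    by move=> x xt; rewrite mem_undup mem_cat xt orbT.
  exists (fun x => a * c x + d x); rewrite uE wE scaler_sumr -big_split/=.
  by apply: eq_bigr => x _; rewrite scalerDl scalerA.
move=> /asboolP[s [us [c vE]]].
exists [seq x <- s | c x != 0], c; split.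
- exact: filter_uniq.
- rewrite big_filter big_mkcond vE; apply: eq_bigr => x _.
  by case: eqP => //= ->; rewrite scale0r.
- by move=> x; rewrite mem_filter => /andP[].
Qed.

(** A bump at x vanishing outside U and at the other points of [s] takes the value c x on the
    sum. *)
Lemma in_support_decomp (s : seq X) (c : X -> K) (x : X) :
  uniq s -> x \in s -> c x != 0 -> in_support (\sum_(y <- s) c y *: i y) x.
Proof.
move=> us xs cx U oU Ux.
have oV : open (U `&` ~` [set y | (y \in s) && (y != x)]).
  apply: openI => //; rewrite openC; apply: (tychonoff_closed_finite HX).
  by apply: (@sub_finite_set _ _ [set` s]) => [y /andP[]|]; last exact: finite_seq.
have [|g [dg gx gV]] := free_lcs_bump oV (x := x).
  by split=> //=; rewrite eqxx andbF.
exists g; split=> //; last by move=> y nUy; apply: gV => -[].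
have [h hE] := dual_linear dg; subst g.
rewrite linear_sum/= (bigD1_seq x)//= linearZ/= gx big1_seq ?addr0 ?mulr1//.
  by rewrite /GRing.scale /= mulr1.
move=> y /andP[yx ys]; rewrite linearZ/= gV ?scaler0// => -[_ /=].
by rewrite ys yx.
Qed.

Lemma barrel_bounded_finite_support (B : set L) : barrel_bounded B ->
  finite_set [set x | exists2 v, B v & in_support v x].
Proof.
move=> bB; apply: contrapT => Ainf.
have [x [V [xV Vdisj]]] := infinite_disjoint_opens R HX Ainf.
have wit n : exists p : L * (L -> K^o), [/\ B p.1, dual p.2,
    forall y, ~ V n y -> p.2 (i y) = 0 & n%:R < `|p.2 p.1| ].
  have [[v Bv sv] oV Vx] := xV n.
  have [g [dg gv gV]] := sv _ oV Vx.
  (* Multiplying g by m >= (n+1)/|g v| makes its value at v at least n+1 in modulus. *)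
  have [m gm] := real_or_complex_archi (n.+1%:R / g v) HK.
  exists (v, fun u => m%:R *: g u); split=> //=.
  - have [h hE] := dual_linear dg; split.
      move=> a u w; rewrite hE linearP scalerDr !scalerA.
      by rewrite [m%:R * a]mulrC.
    by move=> u; apply: (@cvgZr _ K^o); exact: dg.2.
  - by move=> y nVy; rewrite gV ?scaler0.
  - rewrite normrZ normr_nat; move: gm.
    rewrite normrM normr_nat normfV ler_pdivrMr ?normr_gt0//.
    by apply: lt_le_trans; rewrite ltr_nat.
have [p pP] := choice wit.
have [|v|m mP] := @barrel_bounded_functionals _ _ nat (fun n => (p n).2) B _ _ bB.
- by move=> n; have [] := pP n.
(* Each point of X lies in at most one V k, so on a fixed finite combination all but finitely many
   functionals vanish; the added 1 keeps the bound positive. *)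
- suff [M MP] : exists M, forall n, (M <= n)%N -> (p n).2 v = 0.
    exists (1 + \sum_(n < M) `|(p n).2 v|); first by rewrite ltr_wpDr// sumr_ge0.
    move=> n; have [Mn|nM] := leqP M n.
      by rewrite MP// normr0 addr_ge0// sumr_ge0.
    rewrite (bigD1 (Ordinal nM))//= addrCA lerDl addr_ge0//.
    by rewrite sumr_ge0.
  have [s [c [us -> _]]] := free_lcs_decomp v.
  elim: s {us} => [|y s [M MP]].
    exists 0%N => n _; have [_ dpn _ _] := pP n.
    by have [h ->] := dual_linear dpn; rewrite big_nil linear0.
  have [N NP] : exists N, forall n, (N <= n)%N -> (p n).2 (i y) = 0.
    have [[k Vky]|nV] := pselect (exists k, V k y).
      exists k.+1 => n kn; have [_ _ + _] := pP n; apply => Vny.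
      by move: kn; rewrite (Vdisj _ _ _ Vky Vny) ltnn.
    by exists 0%N => n _; have [_ _ + _] := pP n; apply => Vny; apply: nV; exists n.
  exists (maxn M N) => n; rewrite geq_max => /andP[/MP Mn /NP Nn].
  have [_ dpn _ _] := pP n; have [h hE] := dual_linear dpn.
  by rewrite big_cons; move: Mn Nn; rewrite hE linearP => -> ->; rewrite scaler0 addr0.
- have [Bv _ _ mlt] := pP m.
  by have := lt_le_trans mlt (mP m _ Bv); rewrite ltxx.
Qed.

(** The finitely many support points have continuous coordinate functionals, each bounded on B. *)
Lemma barrel_bounded_decomp (B : set L) : barrel_bounded B ->
  exists (s : seq X) (m : nat), forall v, B v -> exists c : X -> K,
    v = \sum_(x <- s) c x *: i x /\ forall x, x \in s -> `|c x| <= m%:R.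
Proof.
move=> bB; have /finite_seqP[s0 s0E] := barrel_bounded_finite_support bB.
pose s := undup s0.
have us : uniq s by exact: undup_uniq.
have coord x : exists g : L -> K^o, x \in s ->
    [/\ dual g, g (i x) = 1 & forall y, y \in s -> y != x -> g (i y) = 0].
  have oV : open (~` [set y | (y \in s) && (y != x)]).
    rewrite openC; apply: (tychonoff_closed_finite HX).
    by apply: (@sub_finite_set _ _ [set` s]) => [y /andP[]|]; last exact: finite_seq.
  have [|g [dg gx gV]] := free_lcs_bump oV (x := x).
    by rewrite /= eqxx andbF.
  by exists g => _; split=> // y ys yx; apply: gV => /=; rewrite ys yx; exact.
have [e eP] := choice coord.
have bnd x : exists m : nat, x \in s -> forall v, B v -> `|e x v| <= m%:R.
  have [xs|] := boolP (x \in s); last by exists 0%N.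
  have [de _ _] := eP x xs.
  (* A single functional, viewed as a family indexed by [unit]. *)
  have [|v|m mP] := @barrel_bounded_functionals _ _ unit (fun=> e x) B _ _ bB.
  - by [].
  - by exists (`|e x v| + 1); [rewrite ltr_wpDl|move=> _; rewrite lerDl].
  - by exists m => _ v Bv; exact: mP tt v Bv.
have [m mP] := choice bnd.
exists s, (\max_(x <- s) m x)%N => v Bv.
(* Points with nonzero coefficient lie in the support of v, hence in [s]. *)
have [c vE] : spanned s v.
  have [t [d [ut vE dP]]] := free_lcs_decomp v.
  apply: (@spannedW t) => //; last by exists d.
  move=> x xt; rewrite mem_undup.
  suff : [set` s0] x by [].
  rewrite -s0E; exists v => //; rewrite vE.
  by apply: in_support_decomp => //; exact: dP.
exists c; split=> // x xs.
have [de ex es] := eP x xs.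
have <- : e x v = c x.
  have [h hE] := dual_linear de; rewrite hE in ex es *.
  rewrite vE linear_sum/= (bigD1_seq x)//= linearZ/= ex big1_seq ?addr0.
    by rewrite /GRing.scale /= mulr1.
  by move=> y /andP[yx ys]; rewrite linearZ/= es// scaler0.
apply: le_trans (mP x xs v Bv) _; rewrite ler_nat.
by rewrite (big_rem x)//= leq_maxl.
Qed.

End free_lcs_theory.

(** * From weak* convergence to uniform convergence on barrel-bounded sets *)

Lemma cvg_initial (S : choiceType) (T : topologicalType) (f : S -> T)
    (F : set_system S) (x : S) : Filter F ->
  f @ F --> f x -> F --> (x : initial_topology f).
Proof.
move=> FF fF A [_ [[W oW <-] Wx] WA]; apply: filterS WA _.
by apply: (fF W); exact: open_nbhs_nbhs.
Qed.

Theorem proposition2p10 (R : realType) (K : numFieldType)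
    (HK : real_or_complex R K) (X : topologicalType)
    (HX : tychonoff_space X) (Xinf : infinite_set [set: X])
    (L : tvsType K) (i : X -> L) (HL : free_lcs i) :
  ~ JNP L.
Proof.
apply => u x ux.
have ptw v : (fun n => set_val (u n) v) @ \oo --> set_val x v.
  have : (set_val \o u) @ \oo --> (set_val x : {ptws L -> K^o}).
    apply: cvg_comp ux _.
    exact: (@initial_continuous (dual_weak_star L) {ptws L -> K^o} set_val).
  by move/pointwise_cvgP => /(_ v).
apply: cvg_initial.
apply/fam_cvgP => B bB.
have [s [m sm]] := barrel_bounded_decomp HK HX HL bB.
(* With coefficients at most m on [s], this finite sum dominates the difference of the two
   functionals at every v of B, and it tends to 0 by pointwise convergence at the points of [s]. *)
pose d n : K^o := \sum_(y <- s) m%:R * `|set_val x (i y) - set_val (u n) (i y)|.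
have d0 : d @ \oo --> (0 : K^o).
  rewrite (_ : 0 = \sum_(y <- s) m%:R * `|set_val x (i y) - set_val x (i y)|); last first.
    by rewrite big1// => y _; rewrite subrr normr0 mulr0.
  apply: cvg_big => [|y _]; first exact: add_continuous.
  apply: cvgMr; apply: cvg_norm; apply: cvgB; [exact: cvg_cst|exact: ptw].
move=> A /uniform_nbhs[E [+ EA]].
rewrite -entourage_ballE => -[e /= e0 eE]; rewrite nbhs_simpl /=.
move/cvgr0Pnorm_lt : d0 => /(_ e e0); apply: filterS => n dn.
apply: EA => v Bv; apply: eE; rewrite /= -ball_normE /=.
apply: le_lt_trans dn; have [c [-> cm]] := sm v Bv.
have [f fE] : exists f : {linear L -> K^o}, set_val x = f :=
  dual_linear (set_valP x).
have [g gE] : exists g : {linear L -> K^o}, set_val (u n) = g :=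
  dual_linear (set_valP (u n)).
rewrite [leRHS]ger0_norm; last by apply: sumr_ge0 => y _; rewrite mulr_ge0.
rewrite fE gE (linear_sum f) (linear_sum g) -sumrB.
apply: le_trans (ler_norm_sum _ _ _) _.
rewrite /d fE gE !big_seq; apply: ler_sum => y ys.
by rewrite [f _]linearZ [g _]linearZ -scalerBr normrZ ler_wpM2r// cm.
Qed.
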